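(* Let $(\tau_A:A\to M,\tau_V:V\to M)$ be a Lie affgebroid, $h:V^*\to A^+$ a Hamiltonian section, $R_h$ the Reeb section of the cosymplectic structure $(\Omega_h,\eta)$ on $\mathcal L^{\tau_V^*}\tilde A$, and $S_h=R_h(V^* )\subseteq\rho_A^*(TV^* )$. Under the bijection $\Psi_h$ between the set of curves in $S_h$ and the set of curves in $V^*$ (a curve $c:I\to V^*$ corresponding to the curve $R_h\circ c:I\to S_h$), the admissible curves in the Lagrangian submanifold $S_h$ correspond with the solutions of the Hamilton equations for $h$.
   Context: Everything is smooth. A Lie algebroid $(E,[\cdot,\cdot],\rho)$ over $M$ is a vector bundle $\tau:E\to M$ with a Lie bracket on $\Gamma(E)$ and an anchor $\rho:E\to TM$ with $[X,fY]=f[X,Y]+\rho(X)(f)Y$; $d^E$ is its differential and $\mathcal L^E_X=i_Xd^E+d^Ei_X$. Sections of $E^*$ are identified with fibrewise linear functions on $E$. **Lie affgebroids.** Let $\tau_A:A\to M$ be an affine bundle modelled on $\tau_V:V\to M$, $n=\operatorname{rank}V$. $\tau_{A^+}:A^+=\mathrm{Aff}(A,\mathbb R)\to M$ (fibrewise affine functions), $1_A\in\Gamma(A^+)$ the constant function $1$, $\tilde A=(A^+)^*$, with inclusions $i_A:A\to\tilde A$, $i_A(a)(\varphi)=\varphi(a)$, and its linear part $i_V:V\to\tilde A$. A Lie affgebroid structure on $A$ is a Lie bracket $[\cdot,\cdot]_V$ on $\Gamma(V)$, an $\mathbb R$-linear action $D:\Gamma(A)\times\Gamma(V)\to\Gamma(V)$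 and an affine map $\rho_A:A\to TM$ with $D_X[\bar Y,\bar Z]_V=[D_X\bar Y,\bar Z]_V+[\bar Y,D_X\bar Z]_V$, $D_{X+\bar Y}\bar Z=D_X\bar Z+[\bar Y,\bar Z]_V$, $D_X(f\bar Y)=fD_X\bar Y+\rho_A(X)(f)\bar Y$; $V$ is then a Lie algebroid with anchor the linear part $\rho_V$ of $\rho_A$. It is equivalent to a Lie algebroid structure on $\tilde A$ with $1_A$ a 1-cocycle, via $[i_V\bar Y,i_V\bar Z]_{\tilde A}=i_V[\bar Y,\bar Z]_V$, $[i_AX,i_V\bar Y]_{\tilde A}=i_V(D_X\bar Y)$, $\rho_{\tilde A}\circ i_A=\rho_A$. More generally, a Lie algebroid $U$ with a 1-cocycle $\phi$ nonzero on every fibre makes $\phi^{-1}\{1\}$ a Lie affgebroid modelled on $\phi^{-1}\{0\}$ (structure restricted from $U$), with bidual Lie algebroid $U$. A symplectic section of a Lie algebroid $W$ is a fibrewise nondegenerate $\Omega\in\Gamma(\wedge^2W^* )$ with $d^W\Omega=0$; a Lie affgebroid modelled on such a $W$ is called symplectic. **Prolongations.** For a Lie algebroid $E$ over $M$ and $f:M'\to M$ with $\rho(E_{f(x')})+T_{x'}f(T_{x'}M')=T_{f(x')}M$ for all $x'$, $\mathcal L^fE=\{(b,v')\in E\times TM':\rho(b)=Tf(v')\}$ is a Lie algebroid over $M'$ with anchor $(b,v')\mapsto v'$ and bracket determined by $[(X\circ f,U'),(Y\circ f,W')]=([X,Y]\circ f,[U',W'])$, $U',W'$ being $f$-projectable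 onto $\rho(X),\rho(Y)$. **Hamiltonian data.** $\mu:A^+\to V^*$ sends an affine function to its linear part; a Hamiltonian section is a section $h$ of $\mu$. $\lambda_{\tilde A}(a^* )(b,v)=a^*(b)$ defines a section of $(\mathcal L^{\tau_{A^+}}\tilde A)^*\to A^+$, $\Omega_{\tilde A}=-d\lambda_{\tilde A}$. With $\mathcal Lh(\tilde a,X)=(\tilde a,Th(X))$, $\mathcal Lh:\mathcal L^{\tau_V^*}\tilde A\to\mathcal L^{\tau_{A^+}}\tilde A$, put $\Omega_h=(\mathcal Lh,h)^*\Omega_{\tilde A}$ and $\eta(\tilde a,X)=1_A(\tilde a)$. $(\Omega_h,\eta)$ is a cosymplectic structure on $\mathcal L^{\tau_V^*}\tilde A$ (both closed, $\eta\wedge\Omega_h^n$ nowhere zero); $R_h$ is its Reeb section: $i_{R_h}\Omega_h=0$, $\eta(R_h)=1$. The solutions of the Hamilton equations for $h$ are the integral curves in $V^*$ of the vector field given by the anchor image of $R_h$. **The affgebroid $\rho_A^*(TV^* )$.** $\rho_A^*(TV^* )=\{(a,X)\in A\times TV^*:\rho_A(a)=T\tau_V^*(X)\}=\eta^{-1}\{1\}$, with projection $\widetilde{\pi_{V^*}}(a,X)=\pi_{V^*}(X)$ to $V^*$, is a Lie affgebroid modelled on $\eta^{-1}\{0\}=\mathcal L^{\tau_V^*}V$, with anchor $(a,X)\mapsto X$. It is symplectic with $\Omega_V=-d\lambda_V$, where $\lambda_V(\alpha)(u,X)=\alpha(u)$. Since $\eta(R_h)=1$, $S_h=R_h(V^*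 )$ lies in $\rho_A^*(TV^* )$; it is already known that $S_h$ is a Lagrangian submanifold (in the sense defined below) of this symplectic Lie affgebroid. **Admissible curves in $S_h$.** A curve $\gamma=(\gamma_1,\gamma_2):I\to S_h\subseteq\tilde A\times TV^*$ is admissible if $\gamma_2(t)=\dot c(t)$ for all $t$, where $c=\pi_{V^*}\circ\gamma_2$, $\pi_{V^*}:TV^*\to V^*$. **Complete lift and Lagrangian submanifolds.** Let $\tau_B:B\to N$ be a symplectic Lie affgebroid modelled on $\tau_W:W\to N$ with symplectic section $\Omega$. For $f\in C^\infty(N)$ put $f^c(b)=\rho_B(b)(f)$, $f^v=f\circ\tau_B$. For $X\in\Gamma(W)$, let $(i_W\circ X)^v$ be the vertical lift to $\tilde B$ and $(i_W\circ X)^c$ the complete lift (the unique vector field on $\tilde B$ projectable on $\rho_W(X)$ with $(i_W\circ X)^c(\theta)=\mathcal L^{\tilde B}_{i_W\circ X}\theta$ for $\theta\in\Gamma(B^+)$); both are tangent to $B$, and one sets $X^{\mathbf v}(b)=(0,(i_W\circ X)^v(b))$, $X^{\mathbf c}(b)=(X(\tau_B(b)),(i_W\circ X)^c(b))$ in $\mathcal L^{\tau_B}W$. $\Omega^{\mathbf c}$ is the unique section of $\wedge^2(\mathcal L^{\tau_B}W)^*\to B$ with $\Omega^{\mathbf c}(X^{\mathbf c},Y^{\mathbf c})=\Omega(X,Y)^c$, $\Omega^{\mathbf c}(X^{\mathbf v},Y^{\mathbf c})=\Omega(X,Y)^v$, $\Omega^{\mathbf c}(X^{\mathbf v},Y^{\mathbf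 v})=0$; it is a symplectic section of $\mathcal L^{\tau_B}W$. Let $S\subseteq B$ be a submanifold with inclusion $i$ and $\tau^S=\tau_B\circ i$, such that $\rho_W(W_{\tau^S(s)})+T_s\tau^S(T_sS)=T_{\tau^S(s)}N$ for all $s\in S$. $S$ is Lagrangian if for every $s\in S$ the image of $(\mathcal L^{\tau^S}W)_s$ under $(w,v)\mapsto(w,Ti(v))$ is a Lagrangian subspace of $((\mathcal L^{\tau_B}W)_{i(s)},\Omega^{\mathbf c}(i(s)))$. *)

(* Defs.v *)
From HB Require Import structures.
From mathcomp Require Import all_boot all_order all_algebra.
From mathcomp Require Import all_classical all_reals all_analysis.
Set Implicit Arguments.
Unset Strict Implicit.
Unset Printing Implicit Defensive.
Import Order.TTheory GRing.Theory Num.Theory numFieldNormedType.Exports.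
Local Open Scope classical_set_scope.
Local Open Scope ring_scope.

(* Smooth spaces are handled through their algebras of smooth functions:
   a differential space (Sikorski) is a set with a family of real functions
   that is stable under composition with smooth functions of n variables and
   is local for its own initial topology.  A smooth manifold is a differential
   space that is locally diffeomorphic to open sets of R^m, Hausdorff and second
   countable; this is the usual notion, with smf the algebra C^oo(M).  Total
   spaces of bundles, products and submanifolds get the differential structure
   generated by the evident functions, which for bundles over a manifold is the
   algebra of smooth functions of the usual manifold structure. *)

Section SmoothRn.
Context {R : realType}.

Fixpoint Ck (n k : nat) (w : 'rV[R]_n -> R^o) : Prop :=
  continuous w /\
  if k is k'.+1 then
    forall i : 'I_n, (forall x, derivable w x (delta_mx 0 i)) /\
                     Ck k' (fun x => 'D_(delta_mx 0 i) w x)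
  else True.

Definition smoothRn n (w : 'rV[R]_n -> R^o) := forall k, Ck k w.

Lemma CkW n k (w : 'rV[R]_n -> R^o) : Ck k.+1 w -> Ck k w.
Proof.
elim: k w => [|k IH] w [cw dw]; split=> // i.
by have [d1 d2] := dw i; split=> //; apply: IH.
Qed.

Lemma Ck_cst n k (c : R) : Ck k (fun _ : 'rV[R]_n => c : R^o).
Proof.
elim: k c => [|k IH] c; split; try exact: cst_continuous; first by [].
move=> i; split=> [x|]; first exact: derivable_cst.
rewrite (_ : (fun x => _) = fun=> 0 : R^o); first exact: IH.
by apply/funext => x; rewrite derive_cst.
Qed.

Lemma Ck_add n k (f g : 'rV[R]_n -> R^o) :
  Ck k f -> Ck k g -> Ck k (fun x => f x + g x : R^o).
Proof.
elim: k f g => [|k IH] f g [cf df] [cg dg]; split=> //.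
- by move=> x; exact: cvgD (cf x) (cg x).
- by move=> x; exact: cvgD (cf x) (cg x).
move=> i; have [f1 f2] := df i; have [g1 g2] := dg i.
split=> [x|]; first exact: derivableD.
rewrite (_ : (fun x => _) =
  fun x => 'D_(delta_mx 0 i) f x + 'D_(delta_mx 0 i) g x); first exact: IH.
by apply/funext => x; rewrite (deriveD (f1 x) (g1 x)).
Qed.

Lemma Ck_mul n k (f g : 'rV[R]_n -> R^o) :
  Ck k f -> Ck k g -> Ck k (fun x => f x * g x : R^o).
Proof.
elim: k f g => [|k IH] f g Hf Hg; have [cf df] := Hf; have [cg dg] := Hg.
  by split=> // x; exact: cvgM (cf x) (cg x).
split=> [x|i]; first exact: cvgM (cf x) (cg x).
have [f1 f2] := df i; have [g1 g2] := dg i.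
split=> [x|]; first exact: derivableM.
rewrite (_ : (fun x => _) = fun x => f x * 'D_(delta_mx 0 i) g x +
                                     g x * 'D_(delta_mx 0 i) f x).
  by apply: Ck_add; apply: IH => //; apply: CkW.
by apply/funext => x; rewrite (deriveM (f1 x) (g1 x)).
Qed.

Lemma coord_quotient n (x v : 'rV[R]_n) j :
  (fun h : R => h^-1 *: ((h *: v + x) 0 j - x 0 j : R^o)) @ 0^' --> v 0 j.
Proof.
apply: (@cvg_trans _ ((fun=> v 0 j : R^o) @ 0^')); last exact: cvg_cst.
apply: near_eq_cvg; near=> h.
rewrite !mxE addrK /GRing.scale /= mulrA mulVf ?mul1r//.
near: h; exact: nbhs_dnbhs_neq.
Unshelve. all: by end_near.
Qed.

Lemma Ck_coord n k (j : 'I_n) : Ck k (fun x : 'rV[R]_n => x 0 j : R^o).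
Proof.
case: k => [|k]; split; try exact: coord_continuous; first by [].
move=> i; split=> [x|].
  by apply/cvg_ex; exists ((delta_mx 0 i : 'rV[R]_n) 0 j); exact: coord_quotient.
rewrite (_ : (fun x => _) = fun=> ((delta_mx 0 i : 'rV[R]_n) 0 j : R^o)).
  exact: Ck_cst.
by apply/funext => x; apply/cvg_lim => //; exact: coord_quotient.
Qed.

End SmoothRn.

Record dstruct (R : realType) (T : Type) := DStruct {
  smf : set (T -> R);
  smf_comp : forall n (f : 'I_n -> T -> R) (w : 'rV[R]_n -> R),
    (forall i, smf (f i)) -> smoothRn w -> smf (fun x => w (\row_i f i x));
  smf_local : forall g : T -> R,
    (forall x, exists f k : T -> R,
       [/\ smf f, smf k, f x != 0 & forall y, f y != 0 -> g y = k y]) ->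
    smf g }.

Record dspace (R : realType) := DSpace { dcar :> Type; dstr : dstruct R dcar }.

Section DifferentialSpaces.
Context {R : realType}.
Implicit Types M N : dspace R.

Definition Cinf M : set (M -> R) := smf (dstr M).

Lemma Cinf_lin M a (f g : M -> R) :
  Cinf f -> Cinf g -> Cinf (fun x => a * f x + g x).
Proof.
move=> sf sg.
pose w (u : 'rV[R]_2) : R := a * u 0 0 + u 0 1.
have sw : smoothRn w.
  by move=> k; apply: Ck_add; [apply: Ck_mul; [exact: Ck_cst|]|]; exact: Ck_coord.
have := @smf_comp _ _ (dstr M) 2 (fun i => if i == 0 then f else g) w _ sw.
rewrite (_ : (fun x => w _) = fun x => a * f x + g x).
  by apply=> i; case: ifP.
by apply/funext => x; rewrite /w !mxE.
Qed.

Lemma Cinf_mul M (f g : M -> R) : Cinf f -> Cinf g -> Cinf (fun x => f x * g x).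
Proof.
move=> sf sg.
pose w (u : 'rV[R]_2) : R := u 0 0 * u 0 1.
have sw : smoothRn w by move=> k; apply: Ck_mul; exact: Ck_coord.
have := @smf_comp _ _ (dstr M) 2 (fun i => if i == 0 then f else g) w _ sw.
rewrite (_ : (fun x => w _) = fun x => f x * g x).
  by apply=> i; case: ifP.
by apply/funext => x; rewrite /w !mxE.
Qed.

Definition gen_smf T (F : set (T -> R)) : set (T -> R) :=
  [set g | forall C : dstruct R T, F `<=` smf C -> smf C g].

Lemma gen_comp T (F : set (T -> R)) n (f : 'I_n -> T -> R)
    (w : 'rV[R]_n -> R) :
  (forall i, gen_smf F (f i)) -> smoothRn w ->
  gen_smf F (fun x => w (\row_i f i x)).
Proof. by move=> Hf sw C FC; apply: smf_comp => // i; apply: Hf. Qed.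

Lemma gen_local T (F : set (T -> R)) (g : T -> R) :
  (forall x, exists f k : T -> R,
     [/\ gen_smf F f, gen_smf F k, f x != 0 & forall y, f y != 0 -> g y = k y]) ->
  gen_smf F g.
Proof.
move=> H C FC; apply: smf_local => x; have [f [k [Hf Hk fx fk]]] := H x.
by exists f, k; split=> //; [exact: Hf|exact: Hk].
Qed.

Definition gen T (F : set (T -> R)) : dstruct R T :=
  DStruct (@gen_comp T F) (@gen_local T F).

Lemma gen_sub T (F : set (T -> R)) : F `<=` smf (gen F).
Proof. by move=> g Fg C; apply. Qed.

Definition pull (T : Type) M (p : T -> M) : set (T -> R) :=
  [set g | exists2 f, Cinf f & g = f \o p].

Definition Rn n : dspace R :=
  DSpace (gen [set g | exists i : 'I_n, g = fun x : 'rV[R]_n => x 0 i]).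

Definition Rline : dspace R := DSpace (gen [set (@idfun R : R -> R)]).

Definition subspc M (U : set M) : dspace R :=
  DSpace (gen (pull (fun x : U => set_val x))).

Definition prodspc M N : dspace R :=
  DSpace (gen (pull (@fst M N) `|` pull (@snd M N))).

Definition smooth M N (f : M -> N) := forall g, Cinf g -> Cinf (g \o f).

Record smap M N := SMap { smap_fun :> M -> N; smap_smooth : smooth smap_fun }.

Definition smooth_on M N (U : set M) (f : M -> N) :=
  @smooth (subspc U) N (fun x => f (set_val x)).

Definition diffeo_on M N (U : set M) (W : set N) (f : M -> N) :=
  exists g : N -> M,
    [/\ (forall x, U x -> W (f x) /\ g (f x) = x),
        (forall y, W y -> U (g y) /\ f (g y) = y),
        smooth_on U f & smooth_on W g].

Definition dopen M (U : set M) :=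
  forall x, U x -> exists2 f, Cinf f & f x != 0 /\ (forall y, f y != 0 -> U y).

Definition is_manifold m M :=
  [/\ (forall x : M, exists (U : set M) (W : set (Rn m)) (phi : M -> Rn m),
         [/\ dopen U, U x, dopen W & diffeo_on U W phi]),
      (forall x y : M, x <> y -> exists2 f, Cinf f & f x != f y) &
      (exists B : nat -> set M, (forall i, dopen (B i)) /\
         (forall U x, dopen U -> U x -> exists i, B i x /\ B i `<=` U))].

(* Tangent vectors at x are the derivations of C^oo(M) at x.  They are
   represented as functionals on all functions, with value 0 outside C^oo(M). *)
Definition derivation M (x : M) (v : (M -> R) -> R^o) :=
  [/\ (forall f, ~ Cinf f -> v f = 0),
      (forall a f g, Cinf f -> Cinf g ->
         v (fun y => a * f y + g y) = a * v f + v g) &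
      (forall f g, Cinf f -> Cinf g ->
         v (fun y => f y * g y) = f x * v g + g x * v f)].

Definition derivation_pred M (x : M) : {pred (M -> R) -> R^o} :=
  fun v => `[< derivation x v >].

Lemma derivation_submod M (x : M) : submod_closed (derivation_pred x).
Proof.
split.
  have E f : (0 : (M -> R) -> R^o) f = 0 by [].
  by apply/asboolP; split=> [//|a f g _ _|f g _ _]; rewrite !E !mulr0 addr0.
move=> a v w /asboolP[v0 vl vm] /asboolP[w0 wl wm]; apply/asboolP.
have E f : (a *: v + w) f = a * v f + w f by [].
split=> [f nf|b f g sf sg|f g sf sg]; rewrite !E.
- by rewrite v0 // w0 // mulr0 addr0.
- by rewrite vl // wl // !mulrDr mulrCA !addrA; congr (_ + _); rewrite addrAC.
- rewrite vm // wm // !mulrDr !(mulrCA a) !addrA; congr (_ + _).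
  by rewrite addrAC.
Qed.

HB.instance Definition _ M (x : M) :=
  GRing.isSubmodClosed.Build R ((M -> R) -> R^o) (derivation_pred x)
    (derivation_submod x).

Record tangent M (x : M) := Tangent {
  tv :> (M -> R) -> R^o;
  tvP : tv \in derivation_pred x }.

HB.instance Definition _ M (x : M) := [isSub for @tv M x].
HB.instance Definition _ M (x : M) := [Choice of tangent x by <:].
HB.instance Definition _ M (x : M) :=
  [SubChoice_isSubLmodule of tangent x by <:].

Definition tmap_fun M N (f : smap M N) (x : M) (v : tangent x) :
    (N -> R) -> R^o :=
  fun g => if `[< Cinf g >] then v (g \o f) else 0.

Lemma tmapP M N (f : smap M N) (x : M) (v : tangent x) :
  tmap_fun f v \in derivation_pred (f x).
Proof.
apply/asboolP; have /asboolP[v0 vl vm] := tvP v; rewrite /tmap_fun.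
split=> [g ng|a g k sg sk|g k sg sk].
- by rewrite asboolF.
- rewrite !asboolT //; last exact: Cinf_lin.
  by rewrite -vl //; exact: smap_smooth.
- rewrite !asboolT //; last exact: Cinf_mul.
  by rewrite -(vm (g \o f) (k \o f)) //; exact: smap_smooth.
Qed.

Definition tmap M N (f : smap M N) (x : M) (v : tangent x) : tangent (f x) :=
  Tangent (tmapP f v).

Lemma tmap_linear M N (f : smap M N) (x : M) : linear (@tmap M N f x).
Proof.
move=> a v w; apply: val_inj; apply/funext => g /=.
change (tmap_fun f (a *: v + w) g = a * tmap_fun f v g + tmap_fun f w g).
by rewrite /tmap_fun; case: asboolP => _ //; rewrite mulr0 addr0.
Qed.

HB.instance Definition _ M N (f : smap M N) (x : M) :=
  GRing.isLinear.Build R (tangent x) (tangent (f x)) *:%R (@tmap M N f x)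
    (@tmap_linear M N f x).

End DifferentialSpaces.

Section Bundles.
Context {R : realType}.
Implicit Types M N : dspace R.

(* Local triviality is not part of vfam and afam: it is the predicate
   affine_bundle below, and the duals and prolongations inherit it. *)
Record vfam M := VFam {
  vfib :> M -> lmodType R;
  vds : dstruct R {x : M & vfib x};
  vproj_smooth : forall f, Cinf f -> smf vds (fun e => f (projT1 e)) }.

Definition tot M (E : vfam M) : dspace R := DSpace (vds E).

Definition vproj M (E : vfam M) : smap (tot E) M :=
  @SMap R (tot E) M (fun e => projT1 e) (@vproj_smooth M E).

Definition sect M (E : vfam M) := forall x : M, E x.

Definition graph M (E : vfam M) (X : sect E) : M -> tot E :=
  fun x => existT _ x (X x).

Definition ssect M (E : vfam M) (X : sect E) := smooth (graph X).

Definition tangent_fam M : vfam M.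
Proof.
exists (fun x : M => tangent x : lmodType R)
  (gen (pull (@projT1 M (fun x => tangent x)) `|`
    [set g | exists2 f : M -> R, Cinf f & g = fun e : {x : M & tangent x} => projT2 e f])).
by move=> f sf; apply: gen_sub; left; exists f.
Defined.

Section Dual.
Variable W : lmodType R.

Definition linear_pred : {pred W -> R^o} := fun f => `[< linear f >].

Lemma linear_submod : submod_closed linear_pred.
Proof.
split.
  have E u : (0 : W -> R^o) u = 0 by [].
  by apply/asboolP => a u v; rewrite !E scaler0 addr0.
move=> a f g /asboolP lf /asboolP lg; apply/asboolP => b u v.
have E w : (a *: f + g) w = a *: f w + g w by [].
rewrite !E lf lg !scalerDr !addrA !scalerA [a * b]mulrC; congr (_ + _).
by rewrite addrAC.
Qed.

HB.instance Definition _ :=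
  GRing.isSubmodClosed.Build R (W -> R^o) linear_pred linear_submod.

Record dual := Dual { dual_fun :> W -> R^o; dualP : dual_fun \in linear_pred }.

HB.instance Definition _ := [isSub for dual_fun].
HB.instance Definition _ := [Choice of dual by <:].
HB.instance Definition _ := [SubChoice_isSubLmodule of dual by <:].

End Dual.

Definition dual_fam M (E : vfam M) : vfam M.
Proof.
exists (fun x : M => dual (E x) : lmodType R)
  (gen (pull (@projT1 M (fun x => dual (E x))) `|`
    [set g | exists2 X : sect E, ssect X &
       g = fun e : {x : M & dual (E x)} => projT2 e (X (projT1 e))])).
by move=> f sf; apply: gen_sub; left; exists f.
Defined.

Record afam M (V : vfam M) := AFam {
  afib :> M -> Type;
  aact : forall x, V x -> afib x -> afib x;
  aact0 : forall x (a : afib x), aact 0 a = a;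
  aactD : forall x v w (a : afib x), aact (v + w) a = aact v (aact w a);
  aact_free_trans : forall x (a b : afib x), exists! v, aact v a = b;
  afib_inh : forall x, inhabited (afib x);
  ads : dstruct R {x : M & afib x};
  aproj_smooth : forall f, Cinf f -> smf ads (fun e => f (projT1 e)) }.

Definition atot M (V : vfam M) (A : afam V) : dspace R := DSpace (ads A).

Definition asect M (V : vfam M) (A : afam V) := forall x : M, A x.

Definition sasect M (V : vfam M) (A : afam V) (X : asect A) :=
  @smooth R M (atot A) (fun x => existT _ x (X x)).

(* tau_A : A -> M is an affine bundle modelled on the rank n vector bundle
   tau_V : V -> M: local affine trivialisations, whose linear parts trivialise V. *)
Definition affine_bundle n M (V : vfam M) (A : afam V) :=
  forall x0 : M, exists (U : set M) (psi : forall x, A x -> 'rV[R]_n)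
      (lpsi : forall x, V x -> 'rV[R]_n),
    [/\ dopen U /\ U x0,
        (forall x, U x -> linear (lpsi x)),
        (forall x v a, U x -> psi x (aact v a) = lpsi x v + psi x a),
        @diffeo_on R (atot A) (prodspc M (Rn n))
          [set e | U (projT1 e)] [set y | U y.1]
          (fun e => (projT1 e, psi _ (projT2 e))) &
        @diffeo_on R (tot V) (prodspc M (Rn n))
          [set e | U (projT1 e)] [set y | U y.1]
          (fun e => (projT1 e, lpsi _ (projT2 e)))].

Section AffineDual.
Context {M : dspace R} {V : vfam M} (A : afam V).

Section Fibre.
Variable x : M.

Definition has_linear_part (phi : A x -> R^o) (l : dual (V x)) :=
  forall v a, phi (aact v a) = l v + phi a.

Definition affine_pred : {pred A x -> R^o} :=
  fun phi => `[< exists l, has_linear_part phi l >].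

Lemma affine_submod : submod_closed affine_pred.
Proof.
split.
  apply/asboolP; exists 0 => v a.
  by change ((0 : R) = 0 + 0); rewrite addr0.
move=> c f g /asboolP[l lf] /asboolP[k kg]; apply/asboolP.
exists (c *: l + k) => v a.
change (c * f (aact v a) + g (aact v a) = (c * l v + k v) + (c * f a + g a)).
by rewrite lf kg mulrDr !addrA; congr (_ + _); rewrite addrAC.
Qed.

HB.instance Definition _ :=
  GRing.isSubmodClosed.Build R (A x -> R^o) affine_pred affine_submod.

Record aff := Aff { aff_fun :> A x -> R^o; affP : aff_fun \in affine_pred }.

HB.instance Definition _ := [isSub for aff_fun].
HB.instance Definition _ := [Choice of aff by <:].
HB.instance Definition _ := [SubChoice_isSubLmodule of aff by <:].

Definition mu (phi : aff) : dual (V x) := projT1 (cid (asboolW (affP phi))).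

Lemma muP (phi : aff) v a : phi (aact v a) = mu phi v + phi a.
Proof. exact: (projT2 (cid (asboolW (affP phi)))). Qed.

Lemma mu_linear : linear mu.
Proof.
move=> c f g; apply: val_inj; apply/funext => v /=.
have [a] := afib_inh A x.
apply: (@addIr _ ((c *: f + g : aff) a)); rewrite -muP.
change (c * f (aact v a) + g (aact v a) =
        (c * mu f v + mu g v) + (c * f a + g a)).
by rewrite !muP mulrDr !addrA; congr (_ + _); rewrite addrAC.
Qed.

Lemma one_affP : (fun=> 1 : R^o) \in affine_pred.
Proof. by apply/asboolP; exists 0 => v a /=; rewrite add0r. Qed.

Definition oneA : aff := Aff one_affP.

Lemma iA_subproof (a : A x) :
  (fun phi : aff => phi a : R^o) \in @linear_pred aff.
Proof. by apply/asboolP => c f g. Qed.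

Definition iA (a : A x) : dual aff := Dual (iA_subproof a).

Lemma iV_subproof (v : V x) :
  (fun phi : aff => mu phi v : R^o) \in @linear_pred aff.
Proof. by apply/asboolP => c f g; rewrite mu_linear. Qed.

Definition iV (v : V x) : dual aff := Dual (iV_subproof v).

End Fibre.

Definition aplus : vfam M.
Proof.
exists (fun x : M => aff x : lmodType R)
  (gen (pull (@projT1 M aff) `|`
    [set g | exists2 X : asect A, sasect X &
       g = fun e : {x : M & aff x} => projT2 e (X (projT1 e))])).
by move=> f sf; apply: gen_sub; left; exists f.
Defined.

Definition bidual : vfam M := dual_fam aplus.

End AffineDual.
End Bundles.

Section LieAlgebroids.
Context {R : realType}.
Implicit Types M N : dspace R.

(* Brackets are total functions on set-theoretic sections; only their values on
   smooth sections are constrained and used. *)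
Definition lie_bracket M (E : vfam M) (br : sect E -> sect E -> sect E) :=
  [/\ (forall X Y, ssect X -> ssect Y -> ssect (br X Y)),
      (forall (a : R) X Y Z, ssect X -> ssect Y -> ssect Z ->
         br X (fun x => a *: Y x + Z x) = fun x => a *: br X Y x + br X Z x),
      (forall X Y, ssect X -> ssect Y -> br X Y = fun x => - br Y X x) &
      (forall X Y Z, ssect X -> ssect Y -> ssect Z -> forall x,
         br X (br Y Z) x + br Y (br Z X) x + br Z (br X Y) x = 0)].

Record lie_algebroid M (E : vfam M) := LieAlgebroid {
  la_br : sect E -> sect E -> sect E;
  la_anchor : forall x, {linear E x -> tangent x};
  la_anchor_smooth : @smooth R (tot E) (tot (tangent_fam M))
    (fun e => existT _ (projT1 e) (la_anchor _ (projT2 e)));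
  la_lie : lie_bracket la_br;
  la_leibniz : forall f X Y, Cinf f -> ssect X -> ssect Y ->
    la_br X (fun x => f x *: Y x) =
    fun x => f x *: la_br X Y x + la_anchor x (X x) f *: Y x }.

(* d^E of a 1-form, evaluated on sections. *)
Definition d1 M (E : vfam M) (L : lie_algebroid E) (theta : forall x, E x -> R)
    (X Y : sect E) (x : M) : R :=
  la_anchor L x (X x) (fun y => theta y (Y y))
  - la_anchor L x (Y x) (fun y => theta y (X y))
  - theta x (la_br L X Y x).

Definition two_form M (E : vfam M) (om : forall x, E x -> E x -> R) :=
  forall x, [/\ (forall a u v w, om x (a *: u + v) w = a * om x u w + om x v w),
                (forall a u v w, om x w (a *: u + v) = a * om x w u + om x w v) &
                (forall u, om x u u = 0)].

(* The 2-form om equals - d^E theta. *)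
Definition is_minus_d M (E : vfam M) (L : lie_algebroid E)
    (theta : forall x, E x -> R) (om : forall x, E x -> E x -> R) :=
  two_form om /\
  (forall X Y, ssect X -> ssect Y ->
     forall x, om x (X x) (Y x) = - d1 L theta X Y x).

Record lie_affgebroid M (V : vfam M) (A : afam V) := LieAffgebroid {
  lf_br : sect V -> sect V -> sect V;
  lf_D : asect A -> sect V -> sect V;
  lf_rhoA : forall x, A x -> tangent x;
  lf_rhoV : forall x, {linear V x -> tangent x};
  lf_rho_affine : forall x (v : V x) (a : A x),
    lf_rhoA (aact v a) = lf_rhoV x v + lf_rhoA a;
  lf_rho_smooth : @smooth R (atot A) (tot (tangent_fam M))
    (fun e => existT _ (projT1 e) (lf_rhoA (projT2 e)));
  lf_lie : lie_bracket lf_br;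
  lf_D_smooth : forall X Y, sasect X -> ssect Y -> ssect (lf_D X Y);
  lf_D_linear : forall X (a : R) Y Z, sasect X -> ssect Y -> ssect Z ->
    lf_D X (fun x => a *: Y x + Z x) = fun x => a *: lf_D X Y x + lf_D X Z x;
  lf_D_br : forall X Y Z, sasect X -> ssect Y -> ssect Z ->
    lf_D X (lf_br Y Z) =
    fun x => lf_br (lf_D X Y) Z x + lf_br Y (lf_D X Z) x;
  lf_D_act : forall X Y Z, sasect X -> ssect Y -> ssect Z ->
    lf_D (fun x => aact (Y x) (X x)) Z = fun x => lf_D X Z x + lf_br Y Z x;
  lf_D_leibniz : forall X f Y, sasect X -> Cinf f -> ssect Y ->
    lf_D X (fun x => f x *: Y x) =
    fun x => f x *: lf_D X Y x + lf_rhoA (X x) f *: Y x }.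

(* L is the Lie algebroid structure on the bidual of A induced by G. *)
Definition is_bidual_algebroid M (V : vfam M) (A : afam V)
    (G : lie_affgebroid A) (L : lie_algebroid (bidual A)) :=
  [/\ (forall Y Z, ssect Y -> ssect Z ->
         la_br L (fun x => iV A (Y x)) (fun x => iV A (Z x)) =
         fun x => iV A (lf_br G Y Z x)),
      (forall (X : asect A) Y, sasect X -> ssect Y ->
         la_br L (fun x => iA (X x)) (fun x => iV A (Y x)) =
         fun x => iV A (lf_D G X Y x)),
      (forall x (a : A x), la_anchor L x (iA a) = lf_rhoA G a) &
      (forall X Y, ssect X -> ssect Y -> forall x,
         d1 L (fun y (e : bidual A y) => e (oneA A y)) X Y x = 0)].

Section Prolongation.
Context {M N : dspace R} {E : vfam M} (L : lie_algebroid E) (f : smap N M).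

Section Fibre.
Variable x : N.

Definition prol_pred : {pred (E (f x) * tangent x)%type} :=
  fun w => la_anchor L _ w.1 == tmap f w.2.

Lemma prol_submod : submod_closed prol_pred.
Proof.
split; first by rewrite /prol_pred unfold_in /= !linear0.
move=> a u v; rewrite !unfold_in => /eqP Hu /eqP Hv /=.
by rewrite !linearP Hu Hv.
Qed.

HB.instance Definition _ :=
  GRing.isSubmodClosed.Build R (E (f x) * tangent x)%type prol_pred prol_submod.

Record prol_fib := Prol {
  prol_val :> (E (f x) * tangent x)%type;
  prolP : prol_val \in prol_pred }.

HB.instance Definition _ := [isSub for prol_val].
HB.instance Definition _ := [Choice of prol_fib by <:].
HB.instance Definition _ := [SubChoice_isSubLmodule of prol_fib by <:].

End Fibre.

(* The total space carries the structure induced from E x TN. *)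
Definition prol : vfam N.
Proof.
exists (fun x : N => prol_fib x : lmodType R)
  (gen (@pull R _ (tot E)
          (fun e : {x : N & prol_fib x} => existT _ (f (projT1 e)) (projT2 e).1)
        `|` @pull R _ (tot (tangent_fam N))
          (fun e : {x : N & prol_fib x} => existT _ (projT1 e) (projT2 e).2))).
move=> g sg; apply: gen_sub; right; exists (fun e => g (projT1 e)) => //.
exact: (@vproj_smooth _ _ (tangent_fam N)).
Defined.

(* A section of prol with first component X \o f has a second component that is
   f-projectable onto rho(X), by definition of the fibres. *)
Definition is_prolongation (P : lie_algebroid prol) :=
  (forall x (w : prol x), la_anchor P x w = w.2) /\
  (forall (Z1 Z2 : sect prol) (X Y : sect E),
     ssect Z1 -> ssect Z2 -> ssect X -> ssect Y ->
     (forall x, (Z1 x).1 = X (f x)) -> (forall x, (Z2 x).1 = Y (f x)) ->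
     forall x,
       (la_br P Z1 Z2 x).1 = la_br L X Y (f x) /\
       (forall g, Cinf g ->
          (la_br P Z1 Z2 x).2 g =
          (Z1 x).2 (fun y => (Z2 y).2 g) - (Z2 x).2 (fun y => (Z1 y).2 g))).

End Prolongation.
End LieAlgebroids.

Section Hamiltonian.
Context {R : realType} {M : dspace R} {V : vfam M} {A : afam V}.
Variable L : lie_algebroid (bidual A).

(* L^{tau_{A^+}} A~ and L^{tau_V^*} A~ *)
Definition prolA : vfam (tot (aplus A)) := prol L (vproj (aplus A)).
Definition prolV : vfam (tot (dual_fam V)) := prol L (vproj (dual_fam V)).

Definition lambdaA (p : tot (aplus A)) (w : prolA p) : R := w.1 (projT2 p).

Record ham_section := HamSection {
  hs_fun : forall x : M, dual (V x) -> aff A x;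
  hs_smooth : @smooth R (tot (dual_fam V)) (tot (aplus A))
    (fun p => existT _ (projT1 p) (hs_fun (projT2 p)));
  hs_section : forall x (al : dual (V x)), mu (hs_fun al) = al }.

Definition ham_map (h : ham_section) : smap (tot (dual_fam V)) (tot (aplus A)) :=
  SMap (@hs_smooth h).

Lemma prol_h_subproof (h : ham_section) (p : tot (dual_fam V)) (w : prolV p) :
  ((w.1, tmap (ham_map h) w.2)
     : bidual A (vproj (aplus A) (ham_map h p)) * tangent (ham_map h p))%type
  \in prol_pred L (f := vproj (aplus A)) (x := ham_map h p).
Proof.
rewrite unfold_in; apply/eqP; have /eqP -> := prolP w.
apply: val_inj; apply/funext => g /=; rewrite /tmap_fun.
case: asboolP => // sg; rewrite /= /tmap_fun asboolT //.
exact: (@vproj_smooth _ _ (aplus A)).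
Qed.

Definition prol_h (h : ham_section) (p : tot (dual_fam V)) (w : prolV p) :
    prolA (ham_map h p) :=
  Prol (prol_h_subproof h w).

Definition Omega_h (Om : forall p, prolA p -> prolA p -> R) (h : ham_section)
    (p : tot (dual_fam V)) (w1 w2 : prolV p) : R :=
  Om (ham_map h p) (prol_h h w1) (prol_h h w2).

Definition eta (p : tot (dual_fam V)) (w : prolV p) : R := w.1 (oneA A _).

Definition is_reeb (Om : forall p, prolA p -> prolA p -> R) (h : ham_section)
    (Rh : sect prolV) :=
  [/\ ssect Rh, (forall p w, Omega_h Om h (Rh p) w = 0) &
      (forall p, eta (Rh p) = 1)].

(* rho_A^*(TV^* ) = {(a, X) | rho_A(a) = T tau_V^*(X)}, seen in prolV through i_A. *)
Definition rhoA_TV (G : lie_affgebroid A) : set (tot prolV) :=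
  [set w | exists a : A (projT1 (projT1 w)),
     (projT2 w : prolV (projT1 w)).1 = iA a /\
     lf_rhoA G a =
       tmap (vproj (dual_fam V)) (projT2 w : prolV (projT1 w)).2].

Definition S_h (Rh : sect prolV) : set (tot prolV) := range (graph Rh).

End Hamiltonian.

Section Curves.
Context {R : realType}.

Definition curve (I : set R) (N : dspace R) := smap (@subspc R (Rline) I) N.

(* The tangent vector X is the velocity of c at t; at an end point of I the
   derivative is one-sided. *)
Definition is_velocity (I : set R) (N : dspace R) (c : I -> N) (t : I)
    (X : tot (tangent_fam N)) :=
  projT1 X = c t /\
  (forall f, Cinf f ->
     (fun s : I => (f (c s) - f (c t)) / (set_val s - set_val t)) @ t^'
       --> (projT2 X f : R^o)).

Context {M : dspace R} {V : vfam M} {A : afam V} (L : lie_algebroid (bidual A)).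

(* The component in TV^* of an element of L^{tau_V^*} A~, that is, its anchor. *)
Definition TVpart (w : tot (prolV L)) : tot (tangent_fam (tot (dual_fam V))) :=
  existT _ (projT1 w) (projT2 w : prolV L (projT1 w)).2.

Definition admissible (Rh : sect (prolV L)) (I : set R)
    (gam : curve I (subspc (S_h Rh))) :=
  forall t : I,
    is_velocity (fun s : I => projT1 (TVpart (set_val (gam s)))) t
                (TVpart (set_val (gam t))).

Definition hamilton_solution (Rh : sect (prolV L)) (I : set R)
    (c : curve I (tot (dual_fam V))) :=
  forall t : I, is_velocity c t (TVpart (graph Rh (c t))).

End Curves.

Arguments ham_section {R M V} A.

(* Main.v *)
Require Import Defs.
From HB Require Import structures.
From mathcomp Require Import all_boot all_order all_algebra.
From mathcomp Require Import all_classical all_reals all_analysis.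
Set Implicit Arguments.
Unset Strict Implicit.
Unset Printing Implicit Defensive.
Import Order.TTheory GRing.Theory Num.Theory numFieldNormedType.Exports.
Local Open Scope classical_set_scope.
Local Open Scope ring_scope.

(** Both conditions on curves say the same thing once the bijection is
    unfolded.  A point of [S_h Rh] is [graph Rh q] for a unique [q], namely its
    base point, so a curve [gam] in [S_h Rh] is [graph Rh \o c] with [c] the
    base curve of [gam], and [c] is smooth iff [gam] is.  The [TV^*]-component
    of [gam t] is then the anchor image of [Rh] at [c t]: requiring it to be
    the velocity of the base curve (admissibility) is requiring [c] to be an
    integral curve of the anchor image of [Rh] (the Hamilton equations).

    The inclusion of [S_h Rh] in [rho_A^*(TV^* )] needs more.  The Reeb section
    satisfies [eta (Rh p) = 1], that is, the component of [Rh p] in the bidual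
    of [A] takes the value 1 on the constant function 1.  The fibres of [A]
    are finite dimensional, so such a functional is the evaluation at a point
    [a] ([normalized_functional_eval]); the condition
    [rho_A a = T tau_V^* (X)] is then the one that defines the prolongation,
    because the anchor of the bidual restricts to [rho_A] on [A]. *)

Section Smoothness.
Context {R : realType}.

(** Smoothness into a generated structure can be tested on generators because
    the functions [g] with [g \o f] smooth form a differential structure. *)
Lemma smooth_gen (D : dspace R) (T : Type) (F : set (T -> R)) (f : D -> T) :
  (forall g, F g -> Cinf (g \o f)) -> @smooth R D (DSpace (gen F)) f.
Proof.
move=> Ff g Fg.
have compP k (u : 'I_k -> T -> R) (w : 'rV[R]_k -> R) :
    (forall i, Cinf (u i \o f)) -> smoothRn w ->
    Cinf ((fun x => w (\row_i u i x)) \o f).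
  by move=> su sw; apply: (smf_comp (f := fun i => u i \o f)).
have localP (v : T -> R) :
    (forall x, exists u k : T -> R, [/\ Cinf (u \o f), Cinf (k \o f),
       u x != 0 & forall y, u y != 0 -> v y = k y]) -> Cinf (v \o f).
  move=> H; apply: smf_local => x; have [u [k [su sk ux uk]]] := H (f x).
  by exists (u \o f), (k \o f); split=> // y; exact: uk.
exact: (Fg (@DStruct R T [set v : T -> R | Cinf (v \o f)] compP localP) Ff).
Qed.

Lemma smooth_comp (D M N : dspace R) (g : M -> N) (f : D -> M) :
  smooth g -> smooth f -> smooth (g \o f).
Proof. by move=> sg sf k sk; exact: sf (sg k sk). Qed.

Lemma smooth_subspc (D M : dspace R) (U : set M) (f : D -> subspc U) :
  smooth (fun x => set_val (f x) : M) -> smooth f.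
Proof. by move=> sf; apply: smooth_gen => _ [g sg ->]; exact: sf. Qed.

Lemma smooth_set_val (M : dspace R) (U : set M) :
  @smooth R (subspc U) M set_val.
Proof. by move=> g sg; apply: gen_sub; exists g. Qed.

Lemma smap_inj (M N : dspace R) (f g : smap M N) : f =1 g -> f = g.
Proof.
case: f g => [f sf] [g sg] /= /funext fg; case: _ / fg in sg *.
by congr SMap; exact: Prop_irrelevance.
Qed.

End Smoothness.

Section AffineFibre.
Context {R : realType} {M : dspace R} {V : vfam M} (A : afam V).

Lemma dual_linear (W : lmodType R) (l : dual W) : linear l.
Proof. exact: asboolW (dualP l). Qed.

HB.instance Definition _ (W : lmodType R) (l : dual W) :=
  GRing.isLinear.Build R W R^o *:%R (dual_fun l) (dual_linear l).

Lemma dual_lincomb n (W : lmodType R) (l : dual W) (c : R) (u : W)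
    (d : 'I_n -> R) (w : 'I_n -> W) :
  l (c *: u + \sum_j d j *: w j) = c * l u + \sum_j d j * l (w j).
Proof.
rewrite linearD linear_sum linearZ; congr (_ + _).
by apply: eq_bigr => j _; rewrite linearZ.
Qed.

(** In affine coordinates [psi] with origin [a0], every affine function is
    [phi a0 + \sum_j mu phi (b j) * psi_j], where [b] is the basis of [V x] dual
    to the coordinates.  A functional [e] with [e 1 = 1] is thus determined by
    its values on the [psi_j], and these are the coordinates of the point. *)
Lemma normalized_functional_eval n (x : M) (psi : A x -> 'rV[R]_n)
    (lpsi : V x -> 'rV[R]_n) (e : bidual A x) :
  linear lpsi -> (forall v a, psi (aact v a) = lpsi v + psi a) ->
  injective psi -> (forall u, exists a, psi a = u) ->
  e (oneA A x) = 1 -> exists a : A x, e = iA a.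
Proof.
move=> lin psiD psi_inj psi_surj e1.
have [a0 psi0] := psi_surj 0.
have shift a : exists v, aact v a0 = a.
  by have [v []] := aact_free_trans a0 a; exists v.
have lpsi_inj : injective lpsi.
  move=> v w vw; have [u [_ uP]] := aact_free_trans a0 (aact w a0).
  rewrite -(uP w erefl); apply/esym/uP/psi_inj.
  by rewrite !psiD vw.
have /choice[b bP] (j : 'I_n) : exists v, lpsi v = delta_mx 0 j.
  have [a ja] := psi_surj (delta_mx 0 j); have [v va] := shift a.
  by exists v; rewrite -ja -va psiD psi0 addr0.
pose lpsiL := GRing.isLinear.Build R (V x) 'rV[R]_n *:%R lpsi lin.
pose lpsi' : {linear V x -> 'rV[R]_n} := HB.pack lpsi lpsiL.
have expand v : v = \sum_j lpsi v 0 j *: b j.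
  apply: lpsi_inj; rewrite -[RHS]/(lpsi' _) linear_sum /=.
  rewrite {1}[lpsi v]row_sum_delta; apply: eq_bigr => j _.
  by rewrite -[RHS]/(lpsi' _) linearZ /= bP.
have coordP j : (fun a => psi a 0 j : R^o) \in @affine_pred _ _ _ A x.
  have clin : (fun v => lpsi v 0 j : R^o) \in @linear_pred _ (V x).
    by apply/asboolP => c v w; rewrite lin !mxE.
  by apply/asboolP; exists (Dual clin) => v a; rewrite psiD mxE.
pose coord j : aff A x := Aff (coordP j).
have [a psia] := psi_surj (\row_j e (coord j)).
exists a; apply: val_inj; apply/funext => phi /=.
have phiE a' : phi a' = phi a0 + \sum_j psi a' 0 j * mu phi (b j).
  have [v <-] := shift a'.
  rewrite muP {1}[v]expand linear_sum psiD psi0 addr0 addrC; congr (_ + _).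
  by apply: eq_bigr => j _; rewrite linearZ.
pose coefs j : R := mu phi (b j).
have affE : phi = (phi a0 : R) *: oneA A x + \sum_j coefs j *: coord j.
  apply: val_inj; apply/funext => a'.
  (* Evaluation at [a'] is linear in the affine function. *)
  have := dual_lincomb (iA a') (phi a0) (oneA A x) coefs coord.
  rewrite /= mulr1 => ->; rewrite [LHS]phiE.
  by congr (_ + _); apply: eq_bigr => j _; rewrite mulrC.
rewrite {1}affE dual_lincomb e1 mulr1 [RHS]phiE.
by congr (_ + _); apply: eq_bigr => j _; rewrite psia mxE mulrC.
Qed.

(** A bundle trivialisation covers the identity of the base, so on a fibre over
    [U] its fibre component is bijective. *)
Lemma affine_bundle_eval n (x : M) (e : bidual A x) :
  affine_bundle n A -> e (oneA A x) = 1 -> exists a : A x, e = iA a.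
Proof.
move=> /(_ x)[U [psi [lpsi [[_ Ux] lin psiD [g [gl gr _ _]] _]]]].
apply: (@normalized_functional_eval n x (psi x) (lpsi x)).
- exact: lin.
- by move=> v a; exact: psiD.
- move=> a b ab; have [_ ga] := gl (existT _ x a) Ux.
  have [_ gb] := gl (existT _ x b) Ux.
  move: ga; rewrite /= ab gb => /esym; exact: (@existT_inj2 {classic M}).
- move=> u; have [_] := gr (x, u) Ux.
  case: (g _) => y a /= [yx]; case: _ / (esym yx) a => a <-.
  by exists a.
Qed.

End AffineFibre.

Section ReebCurves.
Context {R : realType} {M : dspace R} {V : vfam M} {A : afam V}.
Variable L : lie_algebroid (bidual A).

Lemma S_h_sub_rhoA_TV n (G : lie_affgebroid A) (Rh : sect (prolV L)) :
  affine_bundle n A -> is_bidual_algebroid G L ->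
  (forall p, Defs.eta (Rh p) = 1) -> S_h Rh `<=` rhoA_TV G.
Proof.
move=> bA [_ _ anchorE _] eta1 _ [p _ <-].
have [a Ra] := affine_bundle_eval bA (eta1 p).
exists a; split=> //=; rewrite -anchorE -Ra.
exact/eqP/(prolP (Rh p)).
Qed.

Variables (Rh : sect (prolV L)) (I : set R).

Lemma S_h_graph (w : subspc (S_h Rh)) :
  set_val w = graph Rh (projT1 (set_val w)).
Proof. by have [p _ <-] : S_h Rh (set_val w) := set_valP w. Qed.

Lemma base_curve_smooth (gam : curve I (subspc (S_h Rh))) :
  @smooth R (@subspc R (Rline) I) (tot (dual_fam V))
    (fun t => projT1 (set_val (gam t))).
Proof.
apply: (smooth_comp (smap_smooth (vproj (prolV L)))).
exact: smooth_comp (@smooth_set_val _ _ _) (smap_smooth gam).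
Qed.

Definition base_curve (gam : curve I (subspc (S_h Rh))) :
  curve I (tot (dual_fam V)) := SMap (@base_curve_smooth gam).

Definition reeb_point (p : tot (dual_fam V)) : subspc (S_h Rh) :=
  SigSub (mem_set (imageT (graph Rh) p)).

Hypothesis Rh_smooth : ssect Rh.

Lemma lift_curve_smooth (c : curve I (tot (dual_fam V))) :
  smooth (fun t => reeb_point (c t)).
Proof. exact/smooth_subspc/(smooth_comp Rh_smooth (smap_smooth c)). Qed.

Definition lift_curve (c : curve I (tot (dual_fam V))) :
  curve I (subspc (S_h Rh)) := SMap (@lift_curve_smooth c).

Lemma base_curve_bij : bijective base_curve.
Proof.
exists lift_curve => [gam|c]; apply: smap_inj => t //=.
by apply: val_inj; exact/esym/S_h_graph.
Qed.

End ReebCurves.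

Theorem theorem8p4 (R : realType) (m n : nat) (M : dspace R) (V : vfam M)
    (A : afam V) (G : lie_affgebroid A) (L : lie_algebroid (bidual A))
    (P : lie_algebroid (prolA L)) (Om : forall p, prolA L p -> prolA L p -> R)
    (h : ham_section A) (Rh : sect (prolV L)) (I : set R) :
  is_manifold m M -> affine_bundle n A ->
  is_bidual_algebroid G L ->
  is_prolongation P ->
  is_minus_d P (@lambdaA R M V A L) Om ->
  is_reeb Om h Rh ->
  is_interval I -> (exists s t : R, [/\ I s, I t & s < t]) ->
  S_h Rh `<=` rhoA_TV G /\
  exists Psi : curve I (subspc (S_h Rh)) -> curve I (tot (dual_fam V)),
    [/\ bijective Psi,
        (forall gam c,
           Psi gam = c <-> forall t : I, set_val (gam t) = graph Rh (c t)) &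
        (forall gam, admissible gam <-> hamilton_solution Rh (Psi gam))].
Proof.
move=> _ bA bL _ _ [sR _ eta1] _ _.
split; first exact: S_h_sub_rhoA_TV bA bL eta1.
exists (@base_curve R M V A L Rh I); split; first exact: base_curve_bij.
- move=> gam c; split=> [<- t|gamc]; first exact: S_h_graph.
  by apply: smap_inj => t /=; rewrite gamc.
- (* The base curves agree by definition; only the velocity prescribed at each
     time has to be rewritten. *)
  by move=> gam; split=> adm t; move: (adm t); rewrite /= -S_h_graph.
Qed.
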